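(* Let $p$ be an odd prime and let $a,b,m\in\mathbb Z$ with $m\not\equiv 0\pmod p$. Put $\bar m=2^{12}/m$. Then $$\left(\frac{-m}p\right)\sum_{k=0}^{p-1}\frac{ak+b}{m^k}\binom{2k}k^3+\frac{\bar m^{p-1}+1}4\sum_{k=0}^{p-1}\frac{2ak+a-2b}{\bar m^k}\binom{2k}k^3$$ $$\equiv\frac{ap}2\sum_{k=0}^{p-1}\frac{\binom{2k}k^3}{\bar m^k}+\frac{3p}2\sum_{k=0}^{p-1}\frac{2ak+a-2b}{\bar m^k}\binom{2k}k^3(H_{2k}-H_k)\pmod{p^2}.$$
   Context: $H_k=\sum_{0<j\le k}\frac1j$ denotes the $k$-th harmonic number ($H_0=0$). $\left(\frac{\cdot}{p}\right)$ is the Legendre symbol. A congruence $s\equiv t\pmod{p^2}$ between rational numbers means $s-t\in p^2\mathbb Z_{(p)}$, where $\mathbb Z_{(p)}$ is the ring of rational numbers with denominator prime to $p$. *)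

(* Defs.v *)
From mathcomp Require Import all_boot all_order all_algebra.

Set Implicit Arguments.
Unset Strict Implicit.
Unset Printing Implicit Defensive.

Import GRing.Theory Num.Theory.
Local Open Scope ring_scope.

Definition harmonic_number (k : nat) : rat := \sum_(1 <= j < k.+1) j%:R^-1.

(* The Legendre symbol (a / p), meant for an odd prime p. *)
Definition legendre (a : int) (p : nat) : int :=
  if (p%:Z %| a)%Z then 0
  else if [exists x : 'I_p, ((x : nat)%:Z ^+ 2 == a %[mod p%:Z])%Z] then 1
  else -1.

(* The localization Z_(p), as a subset of rat. *)
Definition Zloc (p : nat) : pred rat := [pred x | coprime p `|denq x|%N].

Definition eqmodloc (p n : nat) (s t : rat) : Prop :=
  exists2 u : rat, u \in Zloc p & s - t = p%:R ^+ n * u.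

(* Main.v *)
(* With n = (p-1)/2, the numbers c_k = binomial(2k,k) / (-4)^k = binomial(-1/2,k)
   are congruent to binomial(n,k) modulo p, hence nearly symmetric under
   k -> n - k.  Comparing consecutive ratios gives, modulo p^2,
     c_{n-k} = c_k (2^(p-1) - p (H_2k - H_k)),
   where the initial case c_n = 2^(p-1) comes from
   (-1)^n binomial(2n,n) = prod (1 - p/i) = prod (1 - p/(2i))^2 = c_n^2.
   The terms with n < k < p vanish modulo p^2, so reversing the sum attached to
   m, i.e. to x = -64/m, turns it into x^n times sums attached to
   1/x = -64/mbar.  By Euler's criterion y = (-m/p) x^n is 1 modulo p, and
   y^2 = x^(p-1) determines it modulo p^2. *)

Require Import Defs.
From HB Require Import structures.
From mathcomp Require Import all_boot all_order all_algebra all_field.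
From mathcomp Require Import ring zify.

Set Implicit Arguments.
Unset Strict Implicit.

Import GRing.Theory Num.Theory.
Local Open Scope ring_scope.

(** * The localization Z_(p) as a subring of the rationals *)

Lemma Zloc_frac (p d : nat) (z : int) (x : rat) :
  coprime p d -> d%:R * x = z%:~R -> x \in Zloc p.
Proof.
move=> cpd dxz; rewrite inE.
have den_d : (denq x %| d%:Z)%Z.
  (* As [numq x] is coprime to [denq x], it suffices that [denq x] divides [numq x * d], which
     equals [z * denq x]. *)
  rewrite -(@Gauss_dvdzr _ (numq x)); last first.
    by rewrite coprimez_sym; exact: coprime_num_den.
  apply/dvdzP; exists z; apply/eqP; rewrite -(eqr_int rat) !intrM numqE -dxz.
  by apply/eqP; rewrite pmulrn; ring.
exact: coprime_dvdr den_d cpd.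
Qed.

Lemma Zloc_subring (p : nat) : subring_closed (Zloc p).
Proof.
have denE x : (`|denq x|%N)%:R * x = (numq x)%:~R.
  by rewrite numqE pmulrn gez0_abs ?denq_ge0 1?mulrC.
split=> [|x y|x y]; rewrite ?inE ?coprimen1 // => cx cy.
- apply: (@Zloc_frac _ (`|denq x| * `|denq y|)
            (numq x * denq y - numq y * denq x)); first by rewrite coprimeMr cx.
  rewrite natrM intrB !intrM -!denE !pmulrn !gez0_abs ?denq_ge0 //; ring.
- apply: (@Zloc_frac _ (`|denq x| * `|denq y|) (numq x * numq y)).
    by rewrite coprimeMr cx.
  by rewrite natrM intrM -!denE; ring.
Qed.

HB.instance Definition _ (p : nat) :=
  GRing.isSubringClosed.Build rat (Zloc p) (Zloc_subring p).

(* rpredD and its kin leave goals about the bundled predicate, which hides the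
   remaining closure instances: each step refolds it to Zloc p. *)
Ltac Zloc_closed p :=
  lazymatch goal with |- is_true (in_mem ?x _) =>
    change (is_true (x \in Zloc p)); first
    [ assumption
    | lazymatch x with
      | _ + _ => apply: rpredD
      | _ * _ => apply: rpredM
      | - _ => rewrite rpredN
      | _ ^+ _ => apply: rpredX
      | _%:R => apply: rpred_nat
      | _%:~R => apply: rpred_int
      | 1 => apply: rpred1
      end ]; Zloc_closed p
  | _ => idtac
  end.

Lemma Zloc_natV (p k : nat) : coprime p k -> k%:R^-1 \in Zloc p.
Proof.
case: k => [|k] cpk; first by rewrite invr0 rpred0.
by apply: (@Zloc_frac p k.+1 1) => //; rewrite mulfV // pnatr_eq0.
Qed.

Lemma Zloc_intV (p : nat) (m : int) : prime p -> ~~ (p%:Z %| m)%Z ->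
  m%:~R^-1 \in Zloc p.
Proof.
(* The denominator must be a natural number, so the sign of [m] moves to the numerator. *)
move=> p_pr ndvd; apply: (@Zloc_frac p `|m| (Num.sg m)).
  by rewrite prime_coprime.
have m0 : m != 0 by apply: contraNneq ndvd => ->; rewrite dvdz0.
by rewrite pmulrn abszE normrEsg intrM -mulrA mulfV ?mulr1 ?intr_eq0.
Qed.

Lemma coprime_ltn (p k : nat) : prime p -> (0 < k < p)%N -> coprime p k.
Proof. by move=> p_pr /andP[k0 kp]; rewrite prime_coprime // gtnNdvd. Qed.

(** * Calculus of congruences modulo p^n in Z_(p) *)

Lemma eqmodloc_refl (p n : nat) (x : rat) : eqmodloc p n x x.
Proof. by exists 0; rewrite ?rpred0 // mulr0 subrr. Qed.

Lemma eqmodloc_sym (p n : nat) (x y : rat) :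
  eqmodloc p n x y -> eqmodloc p n y x.
Proof.
by case=> u uZ e; exists (- u); rewrite ?rpredN // mulrN -e opprB.
Qed.

Lemma eqmodloc_trans (p n : nat) (x y z : rat) :
  eqmodloc p n x y -> eqmodloc p n y z -> eqmodloc p n x z.
Proof.
move=> [u uZ eu] [v vZ ev]; exists (u + v); first exact: rpredD.
by rewrite mulrDr -eu -ev; ring.
Qed.

Lemma eqmodlocD (p n : nat) (x y x' y' : rat) :
  eqmodloc p n x x' -> eqmodloc p n y y' -> eqmodloc p n (x + y) (x' + y').
Proof.
move=> [u uZ eu] [v vZ ev]; exists (u + v); first exact: rpredD.
by rewrite mulrDr -eu -ev; ring.
Qed.

(** From x y - x' y' = x (y - y') + y' (x - x'); hence integrality is asked of [x] and [y']. *)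
Lemma eqmodlocM (p n : nat) (x y x' y' : rat) : x \in Zloc p -> y' \in Zloc p ->
  eqmodloc p n x x' -> eqmodloc p n y y' -> eqmodloc p n (x * y) (x' * y').
Proof.
move=> xZ yZ [u uZ eu] [v vZ ev]; exists (x * v + y' * u).
  by rewrite rpredD ?rpredM.
transitivity (x * (y - y') + y' * (x - x')); first by ring.
by rewrite eu ev; ring.
Qed.

Lemma eqmodlocMl (p n : nat) (c x y : rat) : c \in Zloc p ->
  eqmodloc p n x y -> eqmodloc p n (c * x) (c * y).
Proof.
move=> cZ [u uZ e]; exists (c * u); first exact: rpredM.
by rewrite -mulrBr e; ring.
Qed.

Lemma eqmodloc_sum (p n : nat) (I : Type) (r : seq I) (P : pred I)
    (F G : I -> rat) : (forall i, P i -> eqmodloc p n (F i) (G i)) ->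
  eqmodloc p n (\sum_(i <- r | P i) F i) (\sum_(i <- r | P i) G i).
Proof.
move=> FG; apply: (big_ind2 (eqmodloc p n)) => //; first exact: eqmodloc_refl.
by move=> *; apply: eqmodlocD.
Qed.

Lemma eqmodloc_sum0 (p n : nat) (I : Type) (r : seq I) (P : pred I)
    (F : I -> rat) : (forall i, P i -> eqmodloc p n (F i) 0) ->
  eqmodloc p n (\sum_(i <- r | P i) F i) 0.
Proof.
move=> F0; apply: (big_ind (fun x => eqmodloc p n x 0)) => //.
  exact: eqmodloc_refl.
by move=> x y x0 y0; rewrite -[X in eqmodloc _ _ _ X](addr0 0); apply: eqmodlocD.
Qed.

Lemma eqmodloc_prod (p n : nat) (I : Type) (r : seq I) (F G : I -> rat) :
  (forall i, F i \in Zloc p) -> (forall i, G i \in Zloc p) ->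
  (forall i, eqmodloc p n (F i) (G i)) ->
  eqmodloc p n (\prod_(i <- r) F i) (\prod_(i <- r) G i).
Proof.
move=> FZ GZ FG; elim: r => [|i r IH].
  by rewrite !big_nil; apply: eqmodloc_refl.
by rewrite !big_cons; apply: eqmodlocM => //; rewrite rpred_prod.
Qed.

Lemma eqmodloc_dvdz (p : nat) (x y : int) :
  (p%:Z %| x - y)%Z -> eqmodloc p 1 x%:~R y%:~R.
Proof.
case/dvdzP=> z e; exists z%:~R; first exact: rpred_int.
by rewrite -intrB e intrM -pmulrn mulrC.
Qed.

(** * Euler's criterion and Fermat's little theorem *)

Lemma expf_eq1_sqr (F : finFieldType) (n : nat) (x : F) :
  #|F| = n.*2.+1 -> x ^+ n = 1 -> exists y, x = y ^+ 2.
Proof.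
move=> cF xn1.
have n0 : (0 < n)%N by have := finNzRing_gt1 F; rewrite cF ltnS double_gt0.
have unity (y : F) : y != 0 -> y ^+ n.*2 = 1.
  by move=> y0; apply: (mulfI y0); rewrite mulr1 -exprS -cF expf_card.
(* The unit group is cyclic of order 2n. With x = z^i for a generator z, z^(i n) = 1 makes 2n divide
   i n, so i is even. *)
have /hasP[z _ z_prim] : has n.*2.-primitive_root (enum (predC1 (0 : F))).
  apply: cyclic.has_prim_root; rewrite ?double_gt0 ?enum_uniq //.
    by apply/allP=> y; rewrite mem_enum unity_rootE => /unity->.
  by rewrite -cardE cardC1 cF.
have [[i ilt] /= xE] : {i : 'I_n.*2 | x = z ^+ i}.
  by apply: (prim_rootP z_prim); rewrite -mul2n mulnC exprM xn1 expr1n.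
move: xn1; rewrite xE -exprM => /eqP; rewrite -(prim_order_dvd z_prim).
rewrite -mul2n dvdn_pmul2r // dvdn2 => ieven.
by exists (z ^+ i./2); rewrite -exprM muln2 even_halfK.
Qed.

Lemma intr_Fp_eq0 (p : nat) (z : int) : prime p ->
  (z%:~R == 0 :> 'F_p) = (p%:Z %| z)%Z.
Proof. by move=> p_pr; rewrite (dvdz_pcharf (pchar_Fp p_pr)). Qed.

Lemma Fp_fermat (p : nat) (x : 'F_p) : prime p -> x != 0 -> x ^+ p.-1 = 1.
Proof.
move=> p_pr x0; apply: (mulfI x0); rewrite mulr1 -exprS prednK ?prime_gt0 //.
by have := expf_card x; rewrite card_Fp.
Qed.

Lemma legendre_sqr (p : nat) (z : int) :
  ~~ (p%:Z %| z)%Z -> legendre z p ^+ 2 = 1.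
Proof. by rewrite /legendre => /negPf->; case: ifP. Qed.

Lemma euler_criterion (p : nat) (z : int) : prime p -> odd p ->
  ~~ (p%:Z %| z)%Z -> eqmodloc p 1 (z ^+ p./2)%:~R (legendre z p)%:~R.
Proof.
move=> p_pr p_odd ndvd; apply: eqmodloc_dvdz.
have pE : p./2.*2.+1 = p by rewrite -[RHS]odd_double_half p_odd.
rewrite -intr_Fp_eq0 // intrB subr_eq0 rmorphXn /=.
have z0 : z%:~R != 0 :> 'F_p by rewrite intr_Fp_eq0.
have unity (y : 'F_p) : y != 0 -> y ^+ p./2.*2 = 1.
  by move=> y0; have := Fp_fermat p_pr y0; rewrite -[X in X.-1]pE.
rewrite /legendre (negPf ndvd); case: ifP => [/existsP[x]|nsq].
  rewrite eqz_mod_dvd -intr_Fp_eq0 // intrB subr_eq0 rmorphXn /= => /eqP xz.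
  rewrite -xz -exprM mul2n unity //; apply: contraNneq z0 => x0.
  by rewrite -xz x0 expr0n.
(* The square of z^((p-1)/2) is 1, so this power is 1 or -1; the value 1 would make z a square. *)
have /eqP := unity _ z0; rewrite -mul2n mulnC exprM -[X in _ == X](expr1n _ 2).
rewrite eqf_sqr => /orP[/eqP z1|//].
have [||y yE] := @expf_eq1_sqr _ p./2 (z%:~R : 'F_p); rewrite ?card_Fp ?pE //.
have yp : (y < p)%N by have := ltn_ord y; rewrite [X in (_ < X)%N -> _]Fp_cast.
case/existsP: nsq; exists (Ordinal yp) => /=.
by rewrite eqz_mod_dvd -intr_Fp_eq0 // intrB rmorphXn /= -pmulrn natr_Zp yE subrr.
Qed.

Lemma fermat_eqmodloc (p : nat) (z : int) : prime p ->
  ~~ (p%:Z %| z)%Z -> eqmodloc p 1 (z ^+ (p - 1))%:~R 1.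
Proof.
move=> p_pr ndvd; apply: (@eqmodloc_dvdz p _ 1).
have z0 : z%:~R != 0 :> 'F_p by rewrite intr_Fp_eq0.
by rewrite -intr_Fp_eq0 // intrB subr_eq0 rmorphXn /= subn1 Fp_fermat.
Qed.

(** * Reflection of the coefficients binomial(-1/2, k) *)

(* This is binomial(-1/2, k), which is congruent to binomial((p-1)/2, k)
   modulo p; hence the near-symmetry under k -> (p-1)/2 - k. *)
Definition half_bin (k : nat) : rat := 'C(2 * k, k)%:R / (- 4) ^+ k.

Lemma half_binS (k : nat) :
  half_bin k.+1 = half_bin k * - ((2 * k + 1)%:R / (2 * k + 2)%:R).
Proof.
have e : ('C(2 * k.+1, k.+1) * k.+1 = 2 * (2 * k + 1) * 'C(2 * k, k))%N.
  have -> : (2 * k.+1 = (2 * k).+2)%N by lia.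
  have := mul_bin_diag (2 * k).+2 k; have := mul_bin_down (2 * k).+1 k => /=.
  have -> : ((2 * k).+1 - k = k.+1)%N by lia.
  by nia.
have k1 : k%:R + 1 != 0 :> rat by rewrite natr1 pnatr_eq0.
have k2 : 2 * k%:R + 2 != 0 :> rat by rewrite -natrM -natrD pnatr_eq0 addn2.
have p4 : (- 4) ^+ k != 0 :> rat by rewrite expf_neq0.
have : 'C(2 * k.+1, k.+1)%:R * (k%:R + 1)
    = 2 * (2 * k%:R + 1) * 'C(2 * k, k)%:R :> rat.
  by rewrite natr1 -natrM e !natrM natrD natrM.
move/(canRL (mulfK k1)); rewrite /half_bin exprS => ->.
by rewrite ![(2 * k + _)%:R]natrD natrM; field; rewrite k1 k2 p4.
Qed.

Lemma half_bin_prod (k : nat) :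
  half_bin k = \prod_(i < k) - ((2 * i + 1)%:R / (2 * i + 2)%:R).
Proof.
elim: k => [|k IH]; first by rewrite big_ord0 /half_bin bin0 expr0 divr1.
by rewrite big_ord_recr -IH half_binS.
Qed.

Lemma bin_prod (n k : nat) : (k <= n)%N ->
  'C(n, k)%:R = \prod_(i < k) ((n - i)%:R / i.+1%:R) :> rat.
Proof.
elim: k => [|k IH] kn; first by rewrite big_ord0 bin0.
rewrite big_ord_recr -IH 1?ltnW //=; apply: (@mulfI _ k.+1%:R).
  by rewrite pnatr_eq0.
rewrite -natrM mul_bin_left natrM; field.
by rewrite addrC natr1 pnatr_eq0.
Qed.

Section Reflection.

Variable p : nat.
Hypothesis p_pr : prime p.
Hypothesis p_odd : odd p.
Let n := p./2.

Let pE : (2 * n + 1 = p)%N.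
Proof. by rewrite -[RHS]odd_double_half p_odd addnC mul2n. Qed.

(** Reversing only the numerators pairs 2i + 2 with 2(n-1-i) + 1 = p - (2i + 2). *)
Lemma half_bin_mid_prod :
  half_bin n = \prod_(i < n) (1 - p%:R / (2 * i + 2)%:R).
Proof.
rewrite half_bin_prod.
rewrite (eq_bigr (fun i : 'I_n => - (2 * i + 1)%:R * (2 * i + 2)%:R^-1)).
  rewrite big_split /= (reindex_inj rev_ord_inj) -big_split /=.
  apply: eq_bigr => i _.
  have -> : (2 * (n - i.+1) + 1 = p - (2 * i + 2))%N by have := ltn_ord i; lia.
  rewrite natrB; last by have := ltn_ord i; lia.
  have : (2 * i + 2)%:R != 0 :> rat by rewrite pnatr_eq0 addn2.
  by move: (_%:R) => x x0; field.
by move=> i _; rewrite mulNr.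
Qed.

Lemma Zloc_natV_ltn (k : nat) : (0 < k < p)%N -> k%:R^-1 \in Zloc p.
Proof. by move=> kp; apply: Zloc_natV; apply: coprime_ltn. Qed.

(* The factors satisfy 1 - p/i = (1 - p/(2i))^2 modulo p^2. *)
Lemma central_bin_mid :
  eqmodloc p 2 ('C(2 * n, n)%:R * (- 1) ^+ n) (half_bin n ^+ 2).
Proof.
have -> : 'C(2 * n, n)%:R * (- 1) ^+ n
    = \prod_(i < n) (1 - p%:R / i.+1%:R) :> rat.
  rewrite bin_prod; last by lia.
  have -> : (- 1) ^+ n = \prod_(i < n) (- 1) :> rat.
    by rewrite prodr_const card_ord.
  rewrite -big_split; apply: eq_bigr => i _ /=.
  have -> : (2 * n - i = p - i.+1)%N by have := ltn_ord i; lia.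
  rewrite natrB; last by have := ltn_ord i; lia.
  have : i.+1%:R != 0 :> rat by rewrite pnatr_eq0.
  by move: (i.+1%:R) => x x0; field.
rewrite half_bin_mid_prod expr2 -big_split /=.
have VZ (i : 'I_n) : (2 * i + 2)%:R^-1 \in Zloc p.
  by apply: Zloc_natV_ltn; have := ltn_ord i; lia.
have VZ' (i : 'I_n) : i.+1%:R^-1 \in Zloc p.
  by apply: Zloc_natV_ltn; have := ltn_ord i; lia.
apply: eqmodloc_prod => i.
- by rewrite rpredB ?rpred1 ?rpredM ?rpred_nat.
- by rewrite rpredM ?rpredB ?rpred1 ?rpredM ?rpred_nat.
(* The index starts at 0; the difference of the two factors is exactly -p^2 / (2i+2)^2. *)
exists (- (2 * i + 2)%:R^-1 ^+ 2); first by rewrite rpredN rpredX.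
have -> : (2 * i + 2 = 2 * i.+1)%N by lia.
have : i.+1%:R != 0 :> rat by rewrite pnatr_eq0.
by rewrite natrM; move: (i.+1%:R) => x x0; field.
Qed.

Lemma Zloc_half_bin (k : nat) : half_bin k \in Zloc p.
Proof.
rewrite rpredM ?rpred_nat // -exprVn invrN rpredX // rpredN Zloc_natV //.
by rewrite (@coprimeXr 2 p 2) // coprimen2.
Qed.

Lemma Zloc_harmonic_number (k : nat) : (k < p)%N -> harmonic_number k \in Zloc p.
Proof.
move=> kp; rewrite /harmonic_number big_nat_cond rpred_sum // => i /andP[ik _].
by apply: Zloc_natV_ltn; lia.
Qed.

Lemma harmonic_numberS (k : nat) :
  harmonic_number k.+1 = harmonic_number k + k.+1%:R^-1.
Proof. by rewrite /harmonic_number big_nat_recr. Qed.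

Lemma expn2_eqmodloc1 : eqmodloc p 1 (2 ^+ (p - 1)) 1.
Proof.
have := @fermat_eqmodloc p 2 p_pr; rewrite rmorphXn /=; apply.
by rewrite dvdzE /=; rewrite dvdn_prime2 //; apply: contraTneq p_odd => ->.
Qed.

(** The left side of [central_bin_mid] is 4^n c_n = 2^(p-1) c_n, and c_n cancels: its numerators 2i
    + 1 with i < n are prime to p. *)
Lemma half_bin_mid : eqmodloc p 2 (half_bin n) (2 ^+ (p - 1)).
Proof.
have binE : 'C(2 * n, n)%:R = (- 4) ^+ n * half_bin n.
  by rewrite mulrC divfK // expf_neq0.
have inv : (half_bin n)^-1 \in Zloc p.
  rewrite half_bin_prod -prodfV rpred_prod // => i _.
  rewrite invrN invfM invrK rpredN rpredM ?rpred_nat // Zloc_natV_ltn //.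
  by have := ltn_ord i; lia.
have n0 : half_bin n != 0.
  by rewrite mulf_neq0 ?invr_eq0 ?expf_neq0 // pnatr_eq0 -lt0n bin_gt0; lia.
have := eqmodlocMl inv central_bin_mid.
have -> : (half_bin n)^-1 * half_bin n ^+ 2 = half_bin n.
  by rewrite expr2 mulKf.
move/eqmodloc_sym; rewrite binE mulrAC mulrCA mulVf // mulr1 -exprMn mulrNN mulr1.
have -> : (p - 1 = 2 * n)%N by lia.
by rewrite exprM.
Qed.

(** Induction on k: the exact ratios c_(k+1) / c_k and c_(n-k-1) / c_(n-k) are compared, and the
    p-part of their discrepancy is the increment of H_2k - H_k. *)
Lemma half_bin_reflect (k : nat) : (k <= n)%N ->
  eqmodloc p 2 (half_bin (n - k))
    (half_bin k *
     (2 ^+ (p - 1) - p%:R * (harmonic_number (2 * k) - harmonic_number k))).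
Proof.
elim: k => [|k IH] kn.
  rewrite subn0 {2}/half_bin bin0 expr0 divr1 mul1r subrr mulr0 subr0.
  exact: half_bin_mid.
(* Naming 2k + 1 opaquely lets [field] treat it as an atom. *)
have [i iE] : exists i : rat, i = (2 * k + 1)%:R by exists (2 * k + 1)%:R.
have i0 : i != 0 by rewrite iE pnatr_eq0; lia.
have iZ : i^-1 \in Zloc p by rewrite iE Zloc_natV_ltn //; lia.
have jE : (2 * k + 2)%:R = i + 1 by rewrite iE natr1; congr (_%:R); lia.
have j0 : i + 1 != 0 by rewrite -jE pnatr_eq0; lia.
have jZ : (i + 1)^-1 \in Zloc p by rewrite -jE Zloc_natV_ltn //; lia.
have lE : (2 * (n - k.+1) + 1)%:R = p%:R - (i + 1) :> rat.
  by rewrite -jE -natrB; [congr (_%:R)|]; lia.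
have l0 : p%:R - (i + 1) != 0 by rewrite -lE pnatr_eq0; lia.
have lZ : (p%:R - (i + 1))^-1 \in Zloc p by rewrite -lE Zloc_natV_ltn //; lia.
have l'E : (2 * (n - k.+1) + 2)%:R = p%:R - i.
  by rewrite iE -natrB; [congr (_%:R)|]; lia.
have l'0 : p%:R - i != 0 by rewrite -l'E pnatr_eq0; lia.
have l'Z : p%:R - i \in Zloc p by rewrite -l'E rpred_nat.
have {}IH := IH (ltnW kn).
set h := harmonic_number (2 * k) - harmonic_number k in IH.
(* H_(2k) gains 1/i + 1/(i+1), while H_k gains 1/(k+1) = 2/(i+1). *)
have -> : harmonic_number (2 * k.+1) - harmonic_number k.+1
    = h + (i^-1 - (i + 1)^-1).
  rewrite (_ : (2 * k.+1 = (2 * k).+2)%N); last by lia.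
  rewrite !harmonic_numberS /h.
  have -> : (2 * k).+1%:R = i by rewrite iE addn1.
  have -> : (2 * k).+2%:R = i + 1 by rewrite -jE addn2.
  have -> : k.+1%:R = (i + 1) / 2 :> rat.
    by rewrite -jE (_ : (2 * k + 2 = 2 * k.+1)%N) 1?natrM 1?mulrC ?mulKf //; lia.
  by field; rewrite i0 j0.
have hZ : h \in Zloc p by rewrite rpredB ?Zloc_harmonic_number //; lia.
have [e eZ eE] := expn2_eqmodloc1; rewrite expr1 in eE.
move: IH; rewrite (_ : (n - k = (n - k.+1).+1)%N); last by lia.
rewrite half_binS lE l'E.
set c' := half_bin (n - _); set c := half_bin k => IH.
have cE : c = half_bin k.+1 * - ((i + 1) / i).
  by rewrite half_binS jE -iE -/c; field; rewrite i0 j0.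
have c'E : c' = - ((p%:R - i) * (p%:R - (i + 1))^-1) *
    (c' * - ((p%:R - (i + 1)) / (p%:R - i))) by field; rewrite l0 l'0.
rewrite c'E; apply: (@eqmodloc_trans _ _ _
    (- ((p%:R - i) * (p%:R - (i + 1))^-1) * (c * (2 ^+ (p - 1) - p%:R * h)))).
  by apply: eqmodlocMl => //; rewrite rpredN rpredM.
(* The two ratios combine to 1 + p / (i (p-i-1)). Adding the harmonic increment p / (i (i+1)) to its
   p-part leaves p^2 / (i (i+1) (p-i-1)); the term in e - h comes from 2^(p-1) - p h = 1 + p (e -
   h). *)
exists (half_bin k.+1 * i^-1 * (p%:R - (i + 1))^-1 * ((i + 1)^-1 + (e - h))).
  by have cZ := Zloc_half_bin k.+1; Zloc_closed p.
have -> : 2 ^+ (p - 1) = 1 + p%:R * e by rewrite -eE; ring.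
by rewrite cE; field; rewrite i0 j0 l0.
Qed.

(** With 2^(p-1) = 1 + p e and g = e - h, the cube of 1 + p g is 1 + 3 p g modulo p^2, and this is 3
    * 2^(p-1) - 2 - 3 p h. *)
Lemma half_bin_reflect_cube (k : nat) : (k <= n)%N ->
  eqmodloc p 2 (half_bin (n - k) ^+ 3)
    (half_bin k ^+ 3 *
     (3 * 2 ^+ (p - 1) - 2
      - 3 * (p%:R * (harmonic_number (2 * k) - harmonic_number k)))).
Proof.
move=> kn; have := half_bin_reflect kn.
set h := harmonic_number _ - _; set c := half_bin k; set c' := half_bin _.
have hZ : h \in Zloc p by rewrite rpredB ?Zloc_harmonic_number //; lia.
have [e eZ eE] := expn2_eqmodloc1; rewrite expr1 in eE.
have -> : 2 ^+ (p - 1) = 1 + p%:R * e by rewrite -eE; ring.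
case=> w wZ wE.
have c'E : c' = c * (1 + p%:R * (e - h)) + p%:R ^+ 2 * w.
  by rewrite -wE; ring.
pose g := e - h; pose d : rat := p%:R.
have cZ : c \in Zloc p by exact: Zloc_half_bin.
(* The first term is the tail of (1 + p g)^3 past 1 + 3 p g; the second collects what [p^2 w] adds
   when c (1 + p g) + p^2 w is cubed. *)
exists (c ^+ 3 * g ^+ 2 * (3 + d * g) + w * (3 * c ^+ 2 * (1 + d * g) ^+ 2
   + 3 * c * (1 + d * g) * (d ^+ 2 * w) + d ^+ 4 * w ^+ 2)).
  have gZ : g \in Zloc p by exact: rpredB.
  have dZ : d \in Zloc p by exact: rpred_nat.
  by Zloc_closed p.
by rewrite c'E /d /g; ring.
Qed.

(** * Divisibility past the midpoint and integrality of the harmonic terms *)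

Lemma half_bin_dvd (k : nat) : (n < k < p)%N ->
  exists2 z, z \in Zloc p & half_bin k = p%:R * z.
Proof.
(* The factor of index n has numerator 2n + 1 = p. *)
move=> /andP[nk kp]; rewrite half_bin_prod (bigD1 (Ordinal nk)) //= pE.
have factorZ i : (i < k)%N -> (2 * i + 2)%:R^-1 \in Zloc p.
  move=> ik; rewrite Zloc_natV // (_ : (2 * i + 2 = 2 * i.+1)%N); last by lia.
  by rewrite coprimeMr coprimen2 p_odd coprime_ltn //; lia.
set r := \prod_(i < k | _) _.
have rZ : r \in Zloc p.
  by apply: rpred_prod => i _; rewrite rpredN rpredM ?rpred_nat ?factorZ.
exists (- (2 * n + 2)%:R^-1 * r); last by ring.
by rewrite rpredM ?rpredN ?factorZ.
Qed.

Lemma half_bin_sum_trunc (F : nat -> rat) :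
  (forall k, (k < p)%N -> F k \in Zloc p) ->
  eqmodloc p 2 (\sum_(0 <= k < p) F k * half_bin k ^+ 3)
    (\sum_(0 <= k < n.+1) F k * half_bin k ^+ 3).
Proof.
move=> FZ; rewrite (@big_cat_nat _ _ _ n.+1) //=; last by lia.
rewrite -[X in eqmodloc _ _ _ X]addr0.
apply: eqmodlocD; first exact: eqmodloc_refl.
rewrite big_nat_cond; apply: eqmodloc_sum0 => k /andP[kp _].
have [z zZ ->] := half_bin_dvd kp.
exists (F k * (p%:R * z ^+ 3)); last by rewrite subr0; ring.
have FkZ : F k \in Zloc p by apply: FZ; lia.
by Zloc_closed p.
Qed.

(** The only multiple of p in this range is p itself, where the quotient is 1. *)
Lemma Zloc_natV_mul_p (j : nat) : (0 < j < 2 * p)%N -> p%:R / j%:R \in Zloc p.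
Proof.
move=> jp; have [/eqP jE|ndvd] := boolP (j == p).
  by rewrite jE mulfV ?rpred1 // pnatr_eq0; lia.
rewrite rpredM ?rpred_nat // Zloc_natV // prime_coprime //.
by apply/negP => /dvdnP[[|[|q]] jE]; nia.
Qed.

Lemma Zloc_harmonic_number_mul_p (k : nat) : (k < 2 * p)%N ->
  p%:R * harmonic_number k \in Zloc p.
Proof.
move=> kp; rewrite /harmonic_number mulr_sumr big_nat_cond rpred_sum //.
by move=> j /andP[jk _]; apply: Zloc_natV_mul_p; lia.
Qed.

Lemma Zloc_harmonic_diff_mul_p (k : nat) : (k < p)%N ->
  p%:R * (harmonic_number (2 * k) - harmonic_number k) \in Zloc p.
Proof.
by move=> kp; rewrite mulrBr rpredB ?Zloc_harmonic_number_mul_p //; lia.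
Qed.

(** For k > n, H_2k has at most a simple pole at p, which the factor p^3 of c_k^3 absorbs. *)
Lemma Zloc_half_bin_harmonic (k : nat) : (k < p)%N ->
  half_bin k ^+ 3 * (harmonic_number (2 * k) - harmonic_number k) \in Zloc p.
Proof.
move=> kp; have [kn|nk] := leqP k n.
  rewrite rpredM ?rpredX ?Zloc_half_bin //.
  by rewrite rpredB ?Zloc_harmonic_number //; lia.
have [|z zZ ->] := @half_bin_dvd k; first by rewrite nk.
have hZ := Zloc_harmonic_diff_mul_p kp.
set h := harmonic_number _ - _ in hZ *.
rewrite (_ : _ * h = p%:R ^+ 2 * z ^+ 3 * (p%:R * h)); last by ring.
by Zloc_closed p.
Qed.

Lemma Zloc_half : 2^-1 \in Zloc p.
Proof. by rewrite (@Zloc_natV p 2) // coprimen2. Qed.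

(** Both sides are truncated at n, then k is replaced by n - k on the left and
    [half_bin_reflect_cube] is applied to each term. *)
Lemma half_bin_sum_reflect (a b x : rat) :
  a \in Zloc p -> b \in Zloc p -> x \in Zloc p -> x^-1 \in Zloc p -> x != 0 ->
  let t (k : nat) : rat := 2 * a * k%:R + a - 2 * b in
  eqmodloc p 2
    (\sum_(0 <= k < p) (a * k%:R + b) * x ^+ k * half_bin k ^+ 3)
    (x ^+ n *
     (a * p%:R / 2 * \sum_(0 <= k < p) x ^- k * half_bin k ^+ 3
      - (3 * 2 ^+ (p - 1) - 2) / 2 *
          \sum_(0 <= k < p) t k * x ^- k * half_bin k ^+ 3
      + 3 * p%:R / 2 *
          \sum_(0 <= k < p) t k * x ^- k * half_bin k ^+ 3 *
            (harmonic_number (2 * k) - harmonic_number k))).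
Proof.
move=> aZ bZ xZ xVZ x0 t.
have V2 := Zloc_half.
have tZ k : t k \in Zloc p by rewrite /t; Zloc_closed p.
pose h k := harmonic_number (2 * k) - harmonic_number k.
pose u : rat := 2 ^+ (p - 1).
have uZ : u \in Zloc p by rewrite /u; Zloc_closed p.
(* [F] gathers the three sums on the right into one coefficient of c_k^3. *)
pose F k := (a * p%:R / 2 - (3 * u - 2) / 2 * t k + 3 / 2 * t k * (p%:R * h k))
  * x ^- k.
have -> : a * p%:R / 2 * \sum_(0 <= k < p) x ^- k * half_bin k ^+ 3
      - (3 * 2 ^+ (p - 1) - 2) / 2 *
          \sum_(0 <= k < p) t k * x ^- k * half_bin k ^+ 3
      + 3 * p%:R / 2 *
          \sum_(0 <= k < p) t k * x ^- k * half_bin k ^+ 3 *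
            (harmonic_number (2 * k) - harmonic_number k)
    = \sum_(0 <= k < p) F k * half_bin k ^+ 3.
  rewrite !mulr_sumr -sumrB -big_split /=; apply: eq_bigr => k _.
  by rewrite /F -/(h k) -/u; ring.
apply: eqmodloc_trans (half_bin_sum_trunc _) _ => [k _|]; first by Zloc_closed p.
apply: eqmodloc_sym.
apply: eqmodloc_trans (eqmodlocMl _ (half_bin_sum_trunc _)) _.
- exact: rpredX.
- move=> k kp; have hZ := Zloc_harmonic_diff_mul_p kp; rewrite -/(h k) in hZ.
  have xkZ : x ^- k \in Zloc p by rewrite -exprVn rpredX.
  by have tkZ := tZ k; rewrite /F; Zloc_closed p.
apply: eqmodloc_sym; rewrite big_nat_rev /= mulr_sumr.
rewrite big_nat_cond [X in eqmodloc _ _ _ X]big_nat_cond.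
apply: eqmodloc_sum => k /andP[kn _]; rewrite add0n subSS.
have {}kn : (k <= n)%N by lia.
apply: eqmodloc_trans (eqmodlocMl _ (half_bin_reflect_cube kn)) _.
  by Zloc_closed p.
rewrite -/(h k) -/u /F; set c := half_bin k.
have nE : n%:R = (p%:R - 1) / 2 :> rat by rewrite -pE natrD natrM; field.
(* This is where [t] comes from: 2n = p - 1. *)
have -> : a * (n - k)%:R + b = (a * p%:R - t k) / 2.
  by rewrite natrB // nE /t; field.
have xnE : x ^+ n = x ^+ (n - k) * x ^+ k by rewrite -exprD subnK.
have [e eZ eE] := expn2_eqmodloc1; rewrite expr1 -/u in eE.
have {}uE : u = 1 + p%:R * e by rewrite -eE; ring.
(* The only mismatch is a p / 2 times 3 (2^(p-1) - 1 - p h) = 3 p (e - h), already a multiple of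
   p^2. *)
exists (x ^+ (n - k) * c ^+ 3 / 2 * (3 * a * (e - h k))).
  have hZ : h k \in Zloc p by rewrite rpredB ?Zloc_harmonic_number //; lia.
  by have cZ : c \in Zloc p := Zloc_half_bin k; Zloc_closed p.
have xk0 : x ^+ k != 0 by rewrite expf_neq0.
by rewrite xnE uE; field.
Qed.

(** Since -64/m = 8^2 m^(-2) (-m), its n-th power is 8^(p-1) m^(-(p-1)) (-m)^n: Fermat handles the
    first two factors and Euler the last. *)
Lemma legendre_mul_expn (m : int) : ~~ (p%:Z %| m)%Z ->
  eqmodloc p 1 ((legendre (- m) p)%:~R * ((- 4) ^+ 3 / m%:~R) ^+ n) 1.
Proof.
move=> ndvd.
have mVZ := Zloc_intV p_pr ndvd.
have m0 : m%:~R != 0 :> rat.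
  by rewrite intr_eq0; apply: contraNneq ndvd => ->; rewrite dvdz0.
have nE : (p - 1 = 2 * n)%N by lia.
have ndvdN : ~~ (p%:Z %| - m)%Z by rewrite rpredN.
have ndvd8 : ~~ (p%:Z %| 2 ^+ 3)%Z.
  rewrite dvdzE abszX absz_nat Euclid_dvdX // andbT dvdn_prime2 //.
  by apply: contraTneq p_odd => ->.
have -> : ((- 4) ^+ 3 / m%:~R) ^+ n
    = ((2 ^+ 3)%:~R ^+ (p - 1) * m%:~R^-1 ^+ (p - 1)) * (- m)%:~R ^+ n :> rat.
  rewrite nE !exprM -!exprMn intrN rmorphXn; congr (_ ^+ n).
  by move: (m%:~R) m0 => w w0 /=; field.
set chi : rat := (legendre _ _)%:~R.
have chiZ : chi \in Zloc p := rpred_int _ _.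
(* The square of the symbol is 1, so the target can be split to match the three factors. *)
rewrite [X in eqmodloc _ _ _ X](_ : 1 = chi * (1 * 1 * chi)); last first.
  by rewrite !mul1r -expr2 -rmorphXn /= legendre_sqr.
apply: eqmodlocMl => //; have := euler_criterion p_pr p_odd ndvdN.
rewrite -/n -/chi rmorphXn /= => eqchi.
apply: eqmodlocM => //; first by Zloc_closed p.
apply: eqmodlocM => //; rewrite ?rpred1 //; first by Zloc_closed p.
  by have := fermat_eqmodloc p_pr ndvd8; rewrite rmorphXn.
have := eqmodlocMl _ (fermat_eqmodloc p_pr ndvd).
move=> /(_ (m%:~R^-1 ^+ (p - 1)) (rpredX _ mVZ)).
rewrite rmorphXn /= -exprMn mulVf // expr1n mulr1.
exact: eqmodloc_sym.
Qed.

End Reflection.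

(** * From binomial sums to reflected sums, and the final congruence *)

Lemma expr_even_sqr (R : comNzRingType) (c d x y : R) (k n : nat) :
  c ^+ 2 = 1 -> y ^+ 2 = (d ^+ k * x) ^+ 2 ->
  y ^+ (2 * n) = (d ^+ (2 * n)) ^+ k * (c * x ^+ n) ^+ 2.
Proof.
move=> c2 sq; rewrite exprM sq (exprMn 2 c) c2 mul1r.
rewrite -exprM exprMn -!exprM (mulnC n 2).
by congr (d ^+ _ * _); rewrite mulnC.
Qed.

(** Absorbs (-4)^(3k) into the base, for w = m (base x) and for w = mbar (base 1/x). *)
Lemma half_bin_cube (w : rat) (k : nat) : w != 0 ->
  'C(2 * k, k)%:R ^+ 3 / w ^+ k = ((- 4) ^+ 3 / w) ^+ k * half_bin k ^+ 3.
Proof.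
move=> w0; rewrite /half_bin.
have d0 : - 4 != 0 :> rat by [].
move: (- 4) d0 => d d0; rewrite !expr_div_n -!exprM (mulnC k 3).
have := expf_neq0 (3 * k) d0; have := expf_neq0 k w0.
by move: (w ^+ k) (d ^+ _) => v1 v2 v10 v20; field; rewrite v20.
Qed.

Theorem theorem1p5 (p : nat) (a b m : int)
    (p_prime : prime p) (p_odd : odd p) (m_ndvd : ~~ (p%:Z %| m)%Z) :
  let mbar : rat := 2 ^+ 12 / m%:~R in
  eqmodloc p 2
    ((legendre (- m) p)%:~R *
       \sum_(0 <= k < p)
         (a * k%:Z + b)%:~R / m%:~R ^+ k * 'C(2 * k, k)%:R ^+ 3
     + (mbar ^+ (p - 1) + 1) / 4 *
       \sum_(0 <= k < p)
         (2 * a * k%:Z + a - 2 * b)%:~R / mbar ^+ k * 'C(2 * k, k)%:R ^+ 3)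
    (a%:~R * p%:R / 2 *
       \sum_(0 <= k < p) 'C(2 * k, k)%:R ^+ 3 / mbar ^+ k
     + 3 * p%:R / 2 *
       \sum_(0 <= k < p)
         (2 * a * k%:Z + a - 2 * b)%:~R / mbar ^+ k * 'C(2 * k, k)%:R ^+ 3 *
         (harmonic_number (2 * k) - harmonic_number k)).
Proof.
move=> mbar.
have m0 : m%:~R != 0 :> rat.
  by rewrite intr_eq0; apply: contraNneq m_ndvd => ->; rewrite dvdz0.
pose x : rat := (- 4) ^+ 3 / m%:~R.
have x0 : x != 0.
  by apply: mulf_neq0; [exact: expf_neq0 | exact: invr_neq0].
have mbar0 : mbar != 0.
  by apply: mulf_neq0; [exact: expf_neq0 | exact: invr_neq0].
have V2 := Zloc_half p_odd.
have mVZ := Zloc_intV p_prime m_ndvd.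
have xZ : x \in Zloc p by rewrite /x; Zloc_closed p.
have xVE : x^-1 = (- 4) ^+ 3 / mbar.
  by rewrite /x /mbar; move: (m%:~R) m0 => w w0; field.
have xVZ : x^-1 \in Zloc p.
  have -> : x^-1 = - (m%:~R * 2^-1 ^+ 6).
    by rewrite /x; move: (m%:~R) m0 => w w0; field.
  by Zloc_closed p.
pose t (k : nat) : rat := 2 * a%:~R * k%:R + a%:~R - 2 * b%:~R.
have tE (k : nat) : (2 * a * k%:Z + a - 2 * b)%:~R = t k.
  by rewrite /t intrB intrD !intrM -pmulrn.
pose T0 := \sum_(0 <= k < p) x ^- k * half_bin k ^+ 3.
pose T1 := \sum_(0 <= k < p) t k * x ^- k * half_bin k ^+ 3.
pose TH := \sum_(0 <= k < p) t k * x ^- k * half_bin k ^+ 3 *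
  (harmonic_number (2 * k) - harmonic_number k).
pose S1 := \sum_(0 <= k < p) (a%:~R * k%:R + b%:~R) * x ^+ k * half_bin k ^+ 3.
have -> : \sum_(0 <= k < p)
    (a * k%:Z + b)%:~R / m%:~R ^+ k * 'C(2 * k, k)%:R ^+ 3 = S1.
  apply: eq_bigr => k _; rewrite intrD intrM -pmulrn -!mulrA; congr (_ * _).
  by rewrite mulrC (half_bin_cube k m0).
have termE k : (2 * a * k%:Z + a - 2 * b)%:~R / mbar ^+ k * 'C(2 * k, k)%:R ^+ 3
    = t k * x ^- k * half_bin k ^+ 3.
  rewrite tE -mulrA -[RHS]mulrA; congr (t k * _).
  by rewrite mulrC (half_bin_cube k mbar0) -xVE exprVn.
have -> : \sum_(0 <= k < p) (2 * a * k%:Z + a - 2 * b)%:~R / mbar ^+ k *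
    'C(2 * k, k)%:R ^+ 3 = T1 by apply: eq_bigr => k _.
have -> : \sum_(0 <= k < p) (2 * a * k%:Z + a - 2 * b)%:~R / mbar ^+ k *
    'C(2 * k, k)%:R ^+ 3 * (harmonic_number (2 * k) - harmonic_number k) = TH.
  by apply: eq_bigr => k _; rewrite termE.
have -> : \sum_(0 <= k < p) 'C(2 * k, k)%:R ^+ 3 / mbar ^+ k = T0.
  by apply: eq_bigr => k _; rewrite (half_bin_cube k mbar0) -xVE exprVn.
have tZ k : t k \in Zloc p by rewrite /t; Zloc_closed p.
have aZ : a%:~R \in Zloc p by apply: rpred_int.
have bZ : b%:~R \in Zloc p by apply: rpred_int.
have xkZ k : x ^- k \in Zloc p by rewrite -exprVn rpredX.
have cZ k : half_bin k \in Zloc p := Zloc_half_bin p_odd k.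
have T0Z : T0 \in Zloc p.
  by apply: rpred_sum => k _; have := xkZ k; have := cZ k => *; Zloc_closed p.
have THZ : TH \in Zloc p.
  rewrite /TH big_nat_cond; apply: rpred_sum => k /andP[kp _].
  rewrite -mulrA; have := Zloc_half_bin_harmonic p_prime p_odd kp.
  by have := xkZ k; have := tZ k => *; Zloc_closed p.
have T1Z : T1 \in Zloc p.
  apply: rpred_sum => k _.
  by have := xkZ k; have := cZ k; have := tZ k => *; Zloc_closed p.
have reflect : eqmodloc p 2 S1 (x ^+ p./2 *
    (a%:~R * p%:R / 2 * T0 - (3 * 2 ^+ (p - 1) - 2) / 2 * T1 + 3 * p%:R / 2 * TH)).
  exact: (half_bin_sum_reflect p_prime p_odd aZ bZ xZ xVZ x0).
set chi : rat := (legendre _ _)%:~R.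
have chiZ : chi \in Zloc p by apply: rpred_int.
(* Now chi x^n = 1 + p v and 2^(p-1) = 1 + p e with v, e in Z_(p), so every power in the claim
   becomes a polynomial in p, v and e. *)
have [v vZ] := legendre_mul_expn p_prime p_odd m_ndvd.
rewrite -/chi -/x expr1 => vE.
have [e eZ] := expn2_eqmodloc1 p_prime p_odd; rewrite expr1 => eE.
have chi2 : chi ^+ 2 = 1.
  by rewrite -rmorphXn legendre_sqr ?rpredN.
(* In fact mbar = -64 x; squaring removes the sign, and p - 1 is even. *)
have sq : mbar ^+ 2 = (2 ^+ 6 * x) ^+ 2.
  by rewrite /x /mbar; move: (m%:~R) m0 => w w0; field.
have mbarE : mbar ^+ (p - 1) = (2 ^+ (p - 1)) ^+ 6 * (chi * x ^+ p./2) ^+ 2.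
  have -> : (p - 1 = 2 * p./2)%N.
    by rewrite -[X in (X - 1)%N]odd_double_half p_odd mul2n addKn.
  exact: (expr_even_sqr p./2 chi2 sq).
have {}eE : 2 ^+ (p - 1) = 1 + p%:R * e by rewrite -eE; ring.
have {}vE : chi * x ^+ p./2 = 1 + p%:R * v by rewrite -vE; ring.
have := eqmodlocMl chiZ reflect; rewrite mulrA vE eE mbarE eE vE => -[w wZ wE].
(* [w + ...] is the quotient by p^2, with (1 + p e)^6 = 1 + 6 p e + (p e)^2 R;
   the T1 part is ((1 + p e)^6 (1 + p v)^2 + 1 - 2 (1 + p v) (1 + 3 p e)) / 4. *)
pose R := 15 + 20 * (p%:R * e) + 15 * (p%:R * e) ^+ 2 + 6 * (p%:R * e) ^+ 3
  + (p%:R * e) ^+ 4.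
exists (w + v * (a%:~R * 2^-1 * T0 + 3 * 2^-1 * TH) + T1 * 2^-1 ^+ 2 *
    (v ^+ 2 + 6 * e * v + 6 * e * v ^+ 2 * p%:R
     + e ^+ 2 * R * (1 + p%:R * v) ^+ 2)).
  by rewrite /R; Zloc_closed p.
rewrite (canRL (subrK _) wE) /R.
clear -m0; clearbody T0 T1 TH; move: (p%:R) (a%:~R) => q a'.
by field.
Qed.
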